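(* For every $k\ge 1$, the clique complex of $W'_{4,k}$ is a flag $3$-sphere, i.e. it triangulates the $3$-dimensional sphere.
   Context: The clique complex $\mathit{cl}(G)$ of a graph $G$ is the simplicial complex whose faces are the cliques of $G$. For $k\ge1$, the graph $W_{4,k}$ has vertex set $\{a,b\}\cup X_1\cup\dots\cup X_k$ (pairwise disjoint), where $X_i=\{y^i_1,y^i_2,y^i_3,z^i_1,z^i_2,z^i_3\}$. Its edges are: $a$ is adjacent to every vertex of $X_1$ and $b$ to every vertex of $X_k$, with no other edges at $a,b$; within each $X_i$ all pairs are edges except $y^i_sz^i_s$, $s=1,2,3$ (the octahedron graph); no edges between $X_i$ and $X_j$ when $|i-j|>1$; for $1\le i\le k-1$ and $s,t\in\{1,2,3\}$: if $t\ge s$ then $y^i_sy^{i+1}_t$ and $z^i_sz^{i+1}_t$ are edges while $y^i_sz^{i+1}_t$, $z^i_sy^{i+1}_t$ are not, and if $t<s$ then $y^i_sz^{i+1}_t$ and $z^i_sy^{i+1}_t$ are edges while $y^i_sy^{i+1}_t$, $z^i_sz^{i+1}_t$ are not. There are no other edges. The graph $W'_{4,k}$ is obtained from $W_{4,k}$ by adding, for every $1\le i\le k-1$, the two edges $y^i_1z^{i+1}_2$ and $z^i_1y^{i+1}_2$. *)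

(* Defs.v *)
From HB Require Import structures.
From mathcomp Require Import all_boot all_order all_algebra.
From mathcomp Require Import all_classical all_reals all_analysis.

Set Implicit Arguments.
Unset Strict Implicit.
Unset Printing Implicit Defensive.

Import Order.TTheory GRing.Theory Num.Theory.
Import numFieldNormedType.Exports.

Local Open Scope classical_set_scope.
Local Open Scope ring_scope.

Section SimplicialComplexes.
Variable V : finType.
Implicit Type K : {set {set V}}.

(* The empty set counts as a face, and every element of V is a vertex. *)
Definition simplicial_complex K : Prop :=
  [/\ finset.set0 \in K,
      forall v : V, [set v]%SET \in K &
      forall S T : {set V}, S \in K -> T \subset S -> T \in K].

Definition flag K : Prop :=
  forall S : {set V}, minset [pred T : {set V} | T \notin K] S -> #|S| = 2%N.

Definition clique (e : rel V) (S : {set V}) : bool :=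
  [forall u in S, forall v in S, (u != v) ==> e u v].

Definition clique_complex (e : rel V) : {set {set V}} :=
  [set S | clique e S]%SET.

(* Barycentric coordinates; {ptws V -> R} carries the product topology, which
   is the Euclidean one since V is finite. *)
Definition realization (R : realType) K : set {ptws V -> R} :=
  [set x | [/\ forall v, 0 <= x v,
               \sum_(v : V) x v = 1 &
               [set v | x v != 0]%SET \in K]].

End SimplicialComplexes.

Definition homeomorphic (T U : topologicalType) (A : set T) (B : set U) : Prop :=
  exists (f : T -> U) (g : U -> T),
    [/\ set_fun A B f, set_fun B A g,
        {in A, cancel f g} /\ {in B, cancel g f},
        {within A, continuous f} & {within B, continuous g}].

(* The topology of 'rV[R]_d.+1 is induced by the sup norm, hence the usual one. *)
Definition unit_sphere (R : realType) (d : nat) : set 'rV[R]_d.+1 :=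
  [set x | \sum_i x ord0 i ^+ 2 = 1].

Definition flag_sphere (R : realType) (V : finType) (d : nat)
    (K : {set {set V}}) : Prop :=
  [/\ simplicial_complex K, flag K &
      homeomorphic (@realization V R K) (@unit_sphere R d)].

(* inl true is a, inl false is b; for i : 'I_k and s : 'I_3, both counted from
   0, inr (i, true, s) is y^{i+1}_{s+1} and inr (i, false, s) is z^{i+1}_{s+1}. *)
Definition W_vertex (k : nat) : finType := (bool + 'I_k * bool * 'I_3)%type.

(* Each edge is given in at least one direction: from a and b to the layers,
   and from layer i to layer i + 1. *)
Definition W4_arc (k : nat) (u v : W_vertex k) : bool :=
  match u, v with
  | inl true, inr (i, _, _) => i == 0%N :> nat
  | inl false, inr (i, _, _) => i.+1 == k
  | inr (i, c, s), inr (j, c', t) =>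
         [&& i == j, (c, s) != (c', t) & ~~ ((c != c') && (s == t))]
      || ((j == i.+1 :> nat) && (if (s <= t)%N then c == c' else c != c'))
  | _, _ => false
  end.

Definition W4_extra_arc (k : nat) (u v : W_vertex k) : bool :=
  match u, v with
  | inr (i, c, s), inr (j, c', t) =>
      [&& j == i.+1 :> nat, s == 0%N :> nat, t == 1%N :> nat & c != c']
  | _, _ => false
  end.

Definition W4 (k : nat) : rel (W_vertex k) :=
  fun u v => W4_arc u v || W4_arc v u.

Definition W4' (k : nat) : rel (W_vertex k) :=
  fun u v => W4 u v || (W4_extra_arc u v || W4_extra_arc v u).

Lemma W4'_sym (k : nat) : symmetric (@W4' k).
Proof. by move=> u v; rewrite /W4' /W4; congr orb; rewrite orbC. Qed.

Lemma W4'_irr (k : nat) : irreflexive (@W4' k).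
Proof.
move=> [[]|[[i c] s]]; rewrite /W4' /W4 /W4_arc /W4_extra_arc //=.
by rewrite !eqxx /= (ltn_eqF (ltnSn i)).
Qed.

(* Main.v *)
Require Import Defs.
From mathcomp Require Import all_boot all_order all_algebra.
From mathcomp Require Import all_classical all_reals all_analysis.
From mathcomp Require Import ring lra.

(* Subdividing an edge of a graph (the new vertex being joined to both ends and
   to their common neighbours) stellarly subdivides the clique complex, so the
   realization does not change. Six inverse subdivisions near [a] turn
   W'_{4,k+1} into W'_{4,k}: they remove [a] and five vertices of the first
   layer, whose last vertex becomes the new [a]. The complex of W'_{4,1} is the
   boundary of the 4-dimensional cross-polytope, which is radially
   homeomorphic to the sphere. *)

Set Implicit Arguments.
Unset Strict Implicit.
Unset Printing Implicit Defensive.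

Import Order.TTheory GRing.Theory Num.Theory.
Import numFieldNormedType.Exports.

Local Open Scope classical_set_scope.
Local Open Scope ring_scope.

(** * Pointwise continuity into function and matrix spaces, and of real operations *)

Lemma ptws_continuous_at (T U : topologicalType) (V : Type)
    (f : T -> {ptws V -> U}) (x : T) :
  (forall v, continuous_at x (fun t => f t v)) -> continuous_at x f.
Proof.
(* The product topology is the supremum of the topologies induced by the evaluations, so one
   coordinate [v] is treated at a time. *)
move=> cf; apply/cvg_sup => v A [_ /= [[W oW <-] Wfx]] /filterS; apply.
by apply: cf; exact: open_nbhs_nbhs.
Qed.

Lemma ptws_eval_continuous_at (U : topologicalType) (V : eqType) (v : V)
    (x : {ptws V -> U}) :
  continuous_at x (fun y : {ptws V -> U} => y v).
Proof. exact: (@proj_continuous V (fun=> U) v x). Qed.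

Lemma mx_continuous_at (R : realType) (T : topologicalType) (m n : nat)
    (f : T -> 'M[R]_(m, n)) (x : T) :
  (forall i j, continuous_at x (fun t => f t i j)) -> continuous_at x f.
Proof.
move=> cf; apply/cvg_ballP => e e0.
have: \forall t \near x, forall ij : 'I_m * 'I_n,
    ball (f x ij.1 ij.2) e (f t ij.1 ij.2).
  apply: filter_forall => -[i j]; exact: (cvg_ball (cf i j)).
by apply: filterS => t ft; split=> // i j; exact: (ft (i, j)).
Qed.

Lemma continuous_at_sum (R : realType) (T : topologicalType) (I : Type)
    (r : seq I) (P : pred I) (F : I -> T -> R) (x : T) :
  (forall i, P i -> continuous_at x (F i)) ->
  continuous_at x (fun t => \sum_(i <- r | P i) F i t).
Proof.
by move=> cF; apply: (@cvg_big R I +%R); [exact: add_continuous|].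
Qed.

Section RealContinuousAt.
Variables (R : realType) (T : topologicalType) (x : T).
Implicit Types f g : T -> R.

Lemma continuous_at_cst (a : R) : continuous_at x (fun _ : T => a).
Proof. exact: cvg_cst. Qed.

Lemma continuous_atD f g : continuous_at x f -> continuous_at x g ->
  continuous_at x (fun t => f t + g t).
Proof. exact: (@cvgD R R^o). Qed.

Lemma continuous_atB f g : continuous_at x f -> continuous_at x g ->
  continuous_at x (fun t => f t - g t).
Proof. exact: (@cvgB R R^o). Qed.

Lemma continuous_atN f : continuous_at x f -> continuous_at x (fun t => - f t).
Proof. exact: (@cvgN R R^o). Qed.

Lemma continuous_atM f g : continuous_at x f -> continuous_at x g ->
  continuous_at x (fun t => f t * g t).
Proof. exact: cvgM. Qed.

Lemma continuous_at_min f g : continuous_at x f -> continuous_at x g ->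
  continuous_at x (fun t => Num.min (f t) (g t)).
Proof. exact: (@continuous_min R T f g x). Qed.

Lemma continuous_at_max f g : continuous_at x f -> continuous_at x g ->
  continuous_at x (fun t => Num.max (f t) (g t)).
Proof. exact: (@continuous_max R T f g x). Qed.

Lemma continuous_atV f : f x != 0 -> continuous_at x f ->
  continuous_at x (fun t => (f t)^-1).
Proof. by move=> f0 cf; apply: cvgV. Qed.

Lemma continuous_at_norm f : continuous_at x f ->
  continuous_at x (fun t => `|f t|).
Proof. exact: (@cvg_norm R R^o). Qed.

Lemma continuous_at_sqrt f : continuous_at x f ->
  continuous_at x (fun t => Num.sqrt (f t)).
Proof. by move=> cf; exact: (continuous_comp cf (@sqrt_continuous R _)). Qed.

End RealContinuousAt.

(** * Homeomorphisms between subsets *)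

(* Continuity is required at the points of [A] in the ambient space, not only
   within [A], so that these homeomorphisms compose pointwise. *)
Definition ambient_homeo (T U : topologicalType) (A : set T) (B : set U) :=
  exists (f : T -> U) (g : U -> T),
    [/\ set_fun A B f, set_fun B A g,
        (forall x, A x -> g (f x) = x) /\ (forall y, B y -> f (g y) = y),
        forall x, A x -> continuous_at x f &
        forall y, B y -> continuous_at y g].

Lemma ambient_homeo_refl (T : topologicalType) (A : set T) : ambient_homeo A A.
Proof. by exists id, id; split=> // x _; exact: cvg_id. Qed.

Lemma ambient_homeo_sym (T U : topologicalType) (A : set T) (B : set U) :
  ambient_homeo A B -> ambient_homeo B A.
Proof. by move=> [f [g [fAB gBA [fK gK] cf cg]]]; exists g, f. Qed.

Lemma ambient_homeo_trans (T U X : topologicalType)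
    (A : set T) (B : set U) (C : set X) :
  ambient_homeo A B -> ambient_homeo B C -> ambient_homeo A C.
Proof.
move=> [f [g [fAB gBA [fK gK] cf cg]]] [f' [g' [fBC gCB [fK' gK'] cf' cg']]].
exists (f' \o f), (g \o g'); split.
- by move=> x Ax; apply: fBC; apply: fAB.
- by move=> x Ax; apply: gBA; apply: gCB.
- split=> [x Ax|y Cy] /=; first by rewrite fK' ?fK//; exact: fAB.
  by rewrite gK ?gK'//; exact: gCB.
- by move=> x Ax; apply: continuous_comp; [exact: cf|apply: cf'; exact: fAB].
- by move=> x Ax; apply: continuous_comp; [exact: cg'|apply: cg; exact: gCB].
Qed.

Lemma ambient_homeo_homeomorphic (T U : topologicalType) (A : set T)
    (B : set U) : ambient_homeo A B -> homeomorphic A B.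
Proof.
move=> [f [g [fAB gBA [fK gK] cf cg]]]; exists f, g; split=> //.
- by split=> x /[!inE]; [exact: fK|exact: gK].
- by apply: continuous_in_subspaceT => x /[!inE]; exact: cf.
- by apply: continuous_in_subspaceT => x /[!inE]; exact: cg.
Qed.

(** * Clique complexes and edge subdivision *)

Section FlagSubdivision.
Variable V : finType.
Implicit Types (A : pred V) (e : rel V).

Lemma cliqueP e (S : {set V}) :
  reflect {in S &, forall u v, u != v -> e u v} (clique e S).
Proof.
apply: (iffP 'forall_in_forall_inP) => cS u v uS vS.
  by move=> uv; move: (cS u uS v vS); rewrite uv.
by apply/implyP => uv; exact: cS.
Qed.

(** Deleted vertices are recorded by the predicate [A], so that all complexes in a chain of
    subdivisions live on the same type [V]. *)
Definition cliques_on A e : {set {set V}} :=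
  [set S in clique_complex e | S \subset A]%SET.

Lemma cliques_on_predT e : cliques_on predT e = clique_complex e.
Proof.
apply/setP => S; rewrite !inE (_ : S \subset predT) ?andbT//.
exact/fintype.subsetP.
Qed.

Lemma simplicial_clique_complex e : simplicial_complex (clique_complex e).
Proof.
split=> [|v|S T]; rewrite !inE.
- by apply/cliqueP => u v; rewrite inE.
- by apply/cliqueP => x y /[!inE] /eqP-> /eqP->; rewrite eqxx.
- move=> /cliqueP cS /fintype.subsetP TS; apply/cliqueP => u v uT vT.
  by apply: cS; exact: TS.
Qed.

(** A set that is not a clique contains a non-adjacent pair, which is itself a non-face; minimality
    makes the set equal to that pair. *)
Lemma flag_clique_complex e : flag (clique_complex e).
Proof.
move=> S /minsetP[]; rewrite !inE => nS minS.
have /existsP[u /existsP[v /and4P[uS vS uv euv]]] :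
    [exists u, exists v, [&& u \in S, v \in S, u != v & ~~ e u v]].
  apply: contraNT nS => nS; apply/cliqueP => u v uS vS uv.
  apply: contraNT nS => euv; apply/existsP; exists u; apply/existsP; exists v.
  by rewrite uS vS uv.
rewrite -(minS [set u; v]%SET) ?cards2 ?uv//.
  by rewrite !inE; apply: contra euv => /cliqueP; apply; rewrite ?inE ?eqxx ?orbT.
by rewrite finset.subUset !finset.sub1set uS.
Qed.

Variable R : realType.

Lemma realization_cliques_on A e (x : {ptws V -> R}) :
  @realization V R (cliques_on A e) x <->
  [/\ forall v, 0 <= x v, \sum_v x v = 1, forall v, x v != 0 -> A v &
      forall u v, x u != 0 -> x v != 0 -> u != v -> e u v].
Proof.
rewrite /realization /= !inE; split=> -[x0 x1].
  move=> /andP[/cliqueP xe /fintype.subsetP xA]; split=> // [v xv|u v xu xv].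
    by apply: xA; rewrite inE.
  by apply: xe; rewrite inE.
move=> xA xe; split=> //; apply/andP; split.
  by apply/cliqueP => u v; rewrite !inE; exact: xe.
by apply/fintype.subsetP => v; rewrite inE; exact: xA.
Qed.

(* The graph on [A] is obtained from the one on [A] minus [w] having the edge
   [uv] by subdividing that edge with the new vertex [w]. *)
Definition subdivides A e (w u v : V) : Prop :=
  [&& A w, A u & A v] && [&& w != u, w != v & u != v] &&
  [&& e w u, e w v & ~~ e u v] /\
  forall x, A x -> x != w -> x != u -> x != v -> e w x = e u x && e v x.

Definition add_edge e (u v : V) : rel V := fun x y =>
  [|| (x == u) && (y == v), (x == v) && (y == u) | e x y].

Lemma add_edge_sym e u v : symmetric e -> symmetric (add_edge e u v).
Proof. by move=> es x y; rewrite /add_edge es orbCA ![_ && (x == _)]andbC. Qed.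

Lemma sum_delta (u : V) : \sum_v (v == u)%:R = 1 :> R.
Proof. by rewrite (bigD1 u)//= eqxx big1 ?addr0// => v /negPf->. Qed.

(* The homeomorphism moves the mass of [w] evenly onto [u] and [v]; its inverse
   moves back the common part of the masses of [u] and [v]. Both are shears
   along [c]. *)
Lemma subdivides_homeo A e (w u v : V) : symmetric e -> subdivides A e w u v ->
  ambient_homeo (@realization V R (cliques_on A e))
    (@realization V R (cliques_on (predD1 A w) (add_edge e u v))).
Proof.
move=> es [/andP[/andP[/and3P[Aw Au Av] /and3P[wu wv uv]] /and3P[ewu ewv euv]] ew].
(* In barycentric coordinates [c] is the midpoint of the edge [uv] minus the vertex [w]. Its
   coordinates sum to zero, so moving along [c] keeps the total mass. *)
pose c y : R := (y == u)%:R / 2 + (y == v)%:R / 2 - (y == w)%:R.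
have sumc : \sum_y c y = 0.
  by rewrite sumrB big_split/= -!mulr_suml !sum_delta; lra.
have cu : c u = 1 / 2.
  by rewrite /c eqxx (negPf uv) [u == w]eq_sym (negPf wu) /=; lra.
have cv : c v = 1 / 2.
  by rewrite /c eqxx [v == u]eq_sym (negPf uv) [v == w]eq_sym (negPf wv) /=; lra.
have cw : c w = -1.
  by rewrite /c eqxx (negPf wu) (negPf wv) /=; lra.
have c0 y : y != u -> y != v -> y != w -> c y = 0.
  by rewrite /c => /negPf-> /negPf-> /negPf-> /=; lra.
pose f (x : {ptws V -> R}) : {ptws V -> R} := fun y => x y + x w * c y.
pose g (x : {ptws V -> R}) : {ptws V -> R} :=
  fun y => x y - 2 * Num.min (x u) (x v) * c y.
have fK x : @realization V R (cliques_on A e) x -> g (f x) = x.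
  move=> /realization_cliques_on[x0 _ _ xe].
  (* The vertices [u] and [v] are not adjacent for [e], so a clique misses one of them. After [f]
     the minimum is therefore exactly [x w / 2], the amount that [g] takes back from each. *)
  have m0 : Num.min (x u) (x v) = 0.
    have := x0 u; have := x0 v.
    have [xu0|xu0] := eqVneq (x u) 0; first by rewrite xu0 => xv0 _; rewrite min_l.
    have [xv0|xv0] := eqVneq (x v) 0; first by rewrite xv0 => _ xu1; rewrite min_r.
    by have := xe u v xu0 xv0 uv; rewrite (negPf euv).
  apply/funext => y; rewrite /g /f cu cv.
  by rewrite -addr_minl m0; field.
have gK x : x w = 0 -> f (g x) = x.
  by move=> xw; apply/funext => y; rewrite /f /g xw cw; ring.
exists f, g; split.
- move=> x /realization_cliques_on[x0 x1 xA xe].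
  have f0 y : f x y != 0 ->
      (x y != 0 /\ y != w) \/ (x w != 0 /\ (y = u \/ y = v)).
    rewrite /f; have [->|yw] := eqVneq y w; first by rewrite cw mulrN1 subrr eqxx.
    have [->|yu] := eqVneq y u.
      have [->|xw _] := eqVneq (x w) 0; last by right; auto.
      by rewrite mul0r addr0; left.
    have [->|yv] := eqVneq y v.
      have [->|xw _] := eqVneq (x w) 0; last by right; auto.
      by rewrite mul0r addr0; left.
    by rewrite c0// mulr0 addr0; left.
  (* When [w] carries mass, every further vertex of the support is a neighbour of [w], hence a
     common neighbour of [u] and [v]. *)
  have xadj y : x w != 0 -> x y != 0 -> y != w -> y != u -> y != v ->
      e u y && e v y.
    by move=> xw xy yw yu yv; rewrite -ew ?xe ?xA// eq_sym.
  apply/realization_cliques_on; split.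
  + move=> y; rewrite /f; have [->|yw] := eqVneq y w.
      by rewrite cw mulrN1 subrr.
    apply: addr_ge0 => //; apply: mulr_ge0 => //.
    by rewrite /c (negPf yw) subr0 addr_ge0 ?divr_ge0.
  + by rewrite /f big_split/= -mulr_sumr sumc mulr0 addr0.
  + move=> y /f0[[xy yw]|[_ [->|->]]] /=; rewrite ?inE/=.
    * by rewrite yw; exact: xA.
    * by rewrite eq_sym wu.
    * by rewrite eq_sym wv.
  + have adj y z : y != z -> x w != 0 -> z = u \/ z = v ->
        (x y != 0 /\ y != w) \/ (y = u \/ y = v) -> add_edge e u v y z.
      rewrite /add_edge => yz xw zuv xy.
      have [yu|yu] := eqVneq y u.
        case: zuv => zu; first by rewrite yu zu eqxx in yz.
        by rewrite zu eqxx.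
      have [yv|yv] := eqVneq y v.
        case: zuv => zu; last by rewrite yv zu eqxx in yz.
        by rewrite zu eqxx orbT.
      case: xy => [[xy yw]|[/eqP|/eqP]]; rewrite ?(negPf yu) ?(negPf yv)//.
      by have /andP[? ?] := xadj y xw xy yw yu yv; case: zuv => ->; rewrite es.
    move=> y z /f0 fy /f0 fz yz.
    case: fz => [[xz zw]|[xw zuv]].
      case: fy => [[xy yw]|[xw yuv]]; first by rewrite /add_edge xe// !orbT.
      by rewrite (add_edge_sym _ _ es); apply: adj => //; [rewrite eq_sym|left].
    by apply: adj => //; case: fy => [|[_]]; auto.
- move=> x /realization_cliques_on[x0 x1 xA xe].
  have xw0 : x w = 0 by apply/eqP/contraT => /xA; rewrite /= eqxx.
  pose m := Num.min (x u) (x v).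
  have m0 : 0 <= m by rewrite le_min !x0.
  have xe' y z : x y != 0 -> x z != 0 -> y != z ->
      ~~ ((y == u) && (z == v)) -> ~~ ((y == v) && (z == u)) -> e y z.
    move=> xy xz yz nuv nvu.
    by have := xe y z xy xz yz; rewrite /add_edge (negPf nuv) (negPf nvu).
  have gu : g x u = x u - m by rewrite /g cu -/m; field.
  have gv : g x v = x v - m by rewrite /g cv -/m; field.
  have gw : g x w = 2 * m by rewrite /g cw xw0 -/m; ring.
  have g1 y : y != u -> y != v -> y != w -> g x y = x y.
    by move=> yu yv yw; rewrite /g c0// mulr0 subr0.
  (* Subtracting the minimum empties [u] or [v], so the added edge, which is missing from [e], never
     occurs in the support of [g x]. *)
  have guv : g x u = 0 \/ g x v = 0.
    by rewrite gu gv /m minEle; case: ifP => _; rewrite subrr; auto.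
  have gx y : y != w -> g x y != 0 -> x y != 0.
    move=> yw; apply: contraNneq => xy.
    (* A zero coordinate at [u] or [v] forces the minimum [m] to be zero, so [g] subtracts nothing
       there. *)
    have [yu|yu] := eqVneq y u; last first.
      have [yv|yv] := eqVneq y v; last by rewrite g1 ?xy.
      by rewrite yv gv eq_le subr_le0 subr_ge0 -yv xy m0 -xy yv ge_min lexx orbT.
    by rewrite yu gu eq_le subr_le0 subr_ge0 -yu xy m0 -xy yu ge_min lexx.
  apply/realization_cliques_on; split.
  + move=> y; have [->|yu] := eqVneq y u; first by rewrite gu subr_ge0 ge_min lexx.
    have [->|yv] := eqVneq y v; first by rewrite gv subr_ge0 ge_min lexx orbT.
    have [->|yw] := eqVneq y w; first by rewrite gw mulr_ge0.
    by rewrite g1.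
  + by rewrite /g sumrB -mulr_sumr sumc mulr0 subr0.
  + move=> y gy; have [->//|yw] := eqVneq y w.
    by have /andP[] := xA y (gx y yw gy).
  (* Mass at [w] means that [u] and [v] both carried mass in [x]. Any other support vertex is then
     adjacent to both, hence to [w]. *)
  + have adj z : g x w != 0 -> g x z != 0 -> z != w -> e w z.
      rewrite gw mulf_eq0 pnatr_eq0/= => mn0 gz zw.
      have [->//|zu] := eqVneq z u; have [->//|zv] := eqVneq z v.
      have xz := gx z zw gz; have /andP[_ Az] := xA z xz.
      have [xu xv] : x u != 0 /\ x v != 0.
        split; apply: contraNneq mn0 => x_0; rewrite eq_le m0 -x_0 ge_min lexx//.
        by rewrite orbT.
      by rewrite ew// !xe' ?(eq_sym u) ?(eq_sym v)// ?(negPf zu) ?(negPf zv) ?andbF.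
    move=> y z gy gz yz.
    have [yw|yw] := eqVneq y w; first by
      rewrite yw in gy yz *; apply: adj; rewrite // eq_sym.
    have [zw|zw] := eqVneq z w; first by rewrite zw in gz *; rewrite es; exact: adj.
    apply: xe' => //; (try exact: gx);
      apply/negP => /andP[/eqP yE /eqP zE]; move: gy gz; rewrite yE zE;
      by case: guv => ->; rewrite eqxx.
- split=> // y /realization_cliques_on[_ _ yA _]; apply: gK; apply/eqP.
  by apply: contraT => /yA; rewrite /= eqxx.
- move=> x _; apply: ptws_continuous_at => y; rewrite /f.
  apply: continuous_atD; first exact: ptws_eval_continuous_at.
  apply: continuous_atM; last exact: continuous_at_cst.
  exact: ptws_eval_continuous_at.
- move=> x _; apply: ptws_continuous_at => y; rewrite /g.
  apply: continuous_atB; first exact: ptws_eval_continuous_at.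
  apply: continuous_atM; last exact: continuous_at_cst.
  apply: continuous_atM; first exact: continuous_at_cst.
  by apply: continuous_at_min; exact: ptws_eval_continuous_at.
Qed.

(* The triple [(w, u, v)] stands for the removal of the vertex [w] subdividing
   the edge [uv]. *)
Definition unsubdivide (G : pred V * rel V) (t : V * V * V) :
    pred V * rel V :=
  (predD1 G.1 t.1.1 : pred V, add_edge G.2 t.1.2 t.2).

Fixpoint subdivides_seq (G : pred V * rel V) (ts : seq (V * V * V)) : Prop :=
  if ts is t :: ts' then
    subdivides G.1 G.2 t.1.1 t.1.2 t.2 /\ subdivides_seq (unsubdivide G t) ts'
  else True.

Lemma subdivides_seq_homeo G ts : symmetric G.2 -> subdivides_seq G ts ->
  let H := foldl unsubdivide G ts in
  ambient_homeo (@realization V R (cliques_on G.1 G.2))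
                (@realization V R (cliques_on H.1 H.2)).
Proof.
elim: ts G => [|t ts IH] G Gs /=; first by move=> _; exact: ambient_homeo_refl.
move=> [tG tsG]; apply: ambient_homeo_trans (subdivides_homeo Gs tG) _.
by apply: (IH (unsubdivide G t)) => //; exact: add_edge_sym.
Qed.

End FlagSubdivision.

(** * Renaming the vertices of a graph *)

Lemma relabel_homeo (R : realType) (V W : finType) (h : V -> W) (A : pred W)
    (d : rel V) (e : rel W) : injective h -> (forall w, A w = (w \in codom h)) ->
  (forall u v, u != v -> e (h u) (h v) = d u v) ->
  ambient_homeo (@realization V R (clique_complex d))
    (@realization W R (cliques_on A e)).
Proof.
move=> hI hA he.
(* The pushforward of masses along [h]: as a finite sum over fibres it needs no inverse of [h], and
   continuity and total mass are immediate. *)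
pose f (x : {ptws V -> R}) : {ptws W -> R} := fun w => \sum_(v | h v == w) x v.
pose g (x : {ptws W -> R}) : {ptws V -> R} := fun v => x (h v).
have fE x v : f x (h v) = x v.
  by rewrite /f (big_pred1 v)// => u; rewrite (inj_eq hI).
have fN x w : w \notin codom h -> f x w = 0.
  move=> wh; rewrite /f big_pred0// => v; apply: contraNF wh => /eqP<-.
  exact: codom_f.
have sumf x : \sum_w f x w = \sum_v x v.
  by rewrite /f [RHS](partition_big h xpredT).
have gK y : @realization W R (cliques_on A e) y -> f (g y) = y.
  move=> /realization_cliques_on[_ _ yA _]; apply/funext => w.
  have [/codomP[v ->]|wh] := boolP (w \in codom h); first by rewrite fE.
  rewrite fN//; apply/esym/eqP; apply: contraNT wh => /yA; by rewrite hA.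
rewrite -cliques_on_predT.
exists f, g; split.
- move=> x /realization_cliques_on[x0 x1 _ xd].
  apply/realization_cliques_on; split; rewrite ?sumf//.
  + by move=> w; apply: sumr_ge0.
  + by move=> w; rewrite hA; apply: contraNT => /fN->.
  + move=> w z fw fz wz.
    have /codomP[u wu] : w \in codom h by apply: contraNT fw => /fN->.
    have /codomP[v zv] : z \in codom h by apply: contraNT fz => /fN->.
    move: fw fz wz; rewrite wu zv !fE (inj_eq hI) => xu xv uv.
    by rewrite he// xd.
- move=> y yK; have /realization_cliques_on[y0 y1 yA ye] := yK.
  apply/realization_cliques_on; split=> //.
  + by move=> v; exact: y0.
  + by rewrite -sumf gK.
  + by move=> u v yu yv uv; rewrite -he// ye// (inj_eq hI).
- by split=> // x _; apply/funext => v; rewrite /g fE.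
- move=> x _; apply: ptws_continuous_at => w; rewrite /f.
  by apply: continuous_at_sum => v _; exact: ptws_eval_continuous_at.
- move=> x _; apply: ptws_continuous_at => v; rewrite /g.
  exact: ptws_eval_continuous_at.
Qed.

(** * The boundary of the cross-polytope *)

(** The vertices [(i, true)] and [(i, false)] stand for the two opposite unit vectors on axis [i].
    The difference [d] identifies the realization with the unit sphere of the sum norm; [f] rescales
    it to Euclidean norm one, and [g] divides by the sum norm and splits each coordinate into its
    positive and negative parts. *)
Lemma cross_polytope_homeo (R : realType) (n : nat) :
  ambient_homeo
    (@realization ('I_n.+1 * bool)%type R (clique_complex [rel p q | p.1 != q.1]))
    (@unit_sphere R n).
Proof.
set K := realization _.
pose d (x : {ptws 'I_n.+1 * bool -> R}) i := x (i, true) - x (i, false).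
pose N x := \sum_i d x i ^+ 2.
pose f x : 'rV[R]_n.+1 := \row_i (d x i / Num.sqrt (N x)).
pose s (u : 'rV[R]_n.+1) := \sum_i `|u ord0 i|.
pose g (u : 'rV[R]_n.+1) : {ptws 'I_n.+1 * bool -> R} := fun p =>
  Num.max (if p.2 then u ord0 p.1 else - u ord0 p.1) 0 / s u.
have normE (a : R) : `|a| = Num.max a 0 + Num.max (- a) 0.
  case: (lerP 0 a) => a0; first by rewrite ger0_norm// (max_r (x := - a)) ?oppr_le0// addr0.
  by rewrite ltr0_norm// (max_l (x := - a)) ?oppr_ge0 ?add0r// ltW.
have maxB (a : R) : Num.max a 0 - Num.max (- a) 0 = a.
  case: (lerP 0 a) => a0; first by rewrite (max_r (x := - a)) ?oppr_le0// subr0.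
  by rewrite (max_l (x := - a)) ?oppr_ge0 ?sub0r ?opprK// ltW.
have max_gt0 (a : R) : Num.max a 0 != 0 -> 0 < a.
  by rewrite ltNge; apply: contra => a0; rewrite max_r.
have maxM (a b : R) : 0 < b -> Num.max (a * b) 0 = Num.max a 0 * b.
  by move=> b0; rewrite -[X in Num.max _ X](mul0r b) -maxr_pMl// ltW.
have sum_pair (x : 'I_n.+1 * bool -> R) :
    \sum_p x p = \sum_i (x (i, true) + x (i, false)).
  under [RHS]eq_bigr => i _ do rewrite -(big_bool _ (fun c => x (i, c))).
  by rewrite pair_bigA; apply: eq_bigr => -[].
(* Opposite vertices are not adjacent, so at most one of them carries mass; the two masses are thus
   the positive and negative parts of [d x i]. *)
have KP x : K x -> [/\ forall p, 0 <= x p, \sum_i `|d x i| = 1 &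
    forall i, x (i, true) = Num.max (d x i) 0 /\ x (i, false) = Num.max (- d x i) 0].
  rewrite /K -cliques_on_predT => /realization_cliques_on[x0 x1 _ xe].
  have dE i : x (i, true) = Num.max (d x i) 0 /\ x (i, false) = Num.max (- d x i) 0.
    have xt := x0 (i, true); have xf := x0 (i, false).
    rewrite /d; have [xt0|xt0] := eqVneq (x (i, true)) 0.
      by rewrite xt0 sub0r opprK max_r ?max_l ?oppr_le0.
    have [xf0|xf0] := eqVneq (x (i, false)) 0.
      by rewrite xf0 subr0 max_l ?max_r ?oppr_le0.
    by have := xe _ _ xt0 xf0; rewrite xpair_eqE /= eqxx => /(_ isT).
  split=> //; rewrite -x1 sum_pair; apply: eq_bigr => i _.
  by rewrite normE; case: (dE i) => <- <-.
have N_gt0 x : K x -> 0 < N x.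
  move=> /KP[_ d1 _]; rewrite lt_def sumr_ge0 ?andbT; last by move=> i _; exact: sqr_ge0.
  apply/eqP => /psumr_eq0P d0.
  have : \sum_i `|d x i| = 0.
    apply: big1 => i _; apply/eqP; rewrite normr_eq0 -sqrf_eq0 d0// => j _.
    exact: sqr_ge0.
  by rewrite d1 => /eqP; rewrite oner_eq0.
have s_gt0 u : @unit_sphere R n u -> 0 < s u.
  rewrite /unit_sphere /= => u1; rewrite lt_def sumr_ge0 ?andbT//.
  apply/eqP => /psumr_eq0P u0.
  have : \sum_i u ord0 i ^+ 2 = 0.
    by apply: big1 => i _; apply/eqP; rewrite sqrf_eq0 -normr_eq0 u0.
  by rewrite u1 => /eqP; rewrite oner_eq0.
have dg u i : d (g u) i = u ord0 i / s u.
  by rewrite /d /g /= -mulrBl maxB.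
exists f, g; split.
- move=> x Kx; rewrite /unit_sphere /=.
  under eq_bigr => i _ do rewrite mxE expr_div_n sqr_sqrtr ?(ltW (N_gt0 _ Kx))//.
  by rewrite -mulr_suml divff// gt_eqF// N_gt0.
- move=> u Su; rewrite /K -cliques_on_predT; apply/realization_cliques_on.
  have s0 := s_gt0 u Su; split=> //.
  + move=> p; apply: divr_ge0; last exact: ltW.
    by rewrite le_max lexx orbT.
  + rewrite sum_pair /g /=; under eq_bigr => i _ do rewrite -mulrDl -normE.
    by rewrite -mulr_suml divff// gt_eqF.
  + move=> [i c] [j c'] gi gj ij /=; apply: contraNneq ij => ij; subst j.
    move: gi gj; rewrite /g !mulf_eq0 !negb_or /= => /andP[/max_gt0 + _] /andP[/max_gt0 + _].
    by case: c; case: c' => //=; rewrite oppr_gt0 => u0 u1; have := lt_trans u0 u1; rewrite ltxx.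
- split=> [x Kx|u Su].
    have [x0 d1 dE] := KP x Kx; have N0 := N_gt0 x Kx.
    have sN : 0 < Num.sqrt (N x) by rewrite sqrtr_gt0.
    (* Since [d x] has sum norm one, [s] recovers exactly the factor by which [f] rescaled. *)
    have sE : s (f x) = (Num.sqrt (N x))^-1.
      rewrite /s; under eq_bigr => i _ do
        rewrite mxE normrM (ger0_norm (x := _^-1)) ?invr_ge0 ?ltW//.
      by rewrite -mulr_suml d1 mul1r.
    have ifV : 0 < (Num.sqrt (N x))^-1 by rewrite invr_gt0.
    apply/funext => -[i c]; rewrite /g sE mxE /= invrK.
    by have [xt xf] := dE i; case: c; rewrite ?xt ?xf -?mulNr maxM// mulfVK ?gt_eqF.
  have s0 := s_gt0 u Su.
  have NE : N (g u) = (s u)^-1 ^+ 2.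
    rewrite /N; under eq_bigr => i _ do rewrite dg exprMn.
    by rewrite -mulr_suml Su mul1r.
  apply/rowP => i; rewrite mxE NE sqrtr_sqr ger0_norm ?invr_ge0 ?(ltW s0)//.
  by rewrite dg invrK divfK// gt_eqF.
- have cd x i : continuous_at x (fun t => d t i).
    by apply: continuous_atB; exact: ptws_eval_continuous_at.
  move=> x Kx; apply: mx_continuous_at => i0 i.
  rewrite (_ : (fun t => f t i0 i) = fun t => d t i / Num.sqrt (N t)); last first.
    by apply/funext => t; rewrite mxE.
  apply: continuous_atM => //; apply: continuous_atV.
    by rewrite gt_eqF// sqrtr_gt0 N_gt0.
  apply: continuous_at_sqrt; rewrite /N; apply: continuous_at_sum => j _.
  exact: continuous_atM.
- move=> u Su; have cu i : continuous_at u (fun t : 'rV[R]_n.+1 => t ord0 i).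
    exact: coord_continuous.
  apply: ptws_continuous_at => -[i c]; rewrite /g /=.
  apply: continuous_atM.
    apply: continuous_at_max; last exact: continuous_at_cst.
    case: c; first exact: cu.
    by apply: continuous_atN; exact: cu.
  apply: continuous_atV; first by rewrite gt_eqF// s_gt0.
  by rewrite /s; apply: continuous_at_sum => j _; apply: continuous_at_norm; exact: cu.
Qed.

(** * Removal of one layer *)

Definition layer_vertex (k : nat) (i : 'I_k) (c : bool) (s : nat) : W_vertex k :=
  inr (i, c, inZp s).

(* Of [a] and the first layer only y^1_1 remains, and it takes over the role of
   [a]. The list was found by a computer search. *)
Definition first_layer_moves (k : nat) :
    seq (W_vertex k.+2 * W_vertex k.+2 * W_vertex k.+2) :=
  let x := layer_vertex (@ord0 k.+1) in
  let x' := layer_vertex (lift ord0 (@ord0 k)) in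
  [:: (inl true, x true 1, x false 1);
      (x false 2, x false 1, x' true 1);
      (x true 1, x true 2, x' true 1);
      (x false 0, x true 2, x' false 2);
      (x false 1, x true 0, x' false 2);
      (x true 2, x true 0, x' false 0)]%N.

Definition shift_vertex (k : nat) (v : W_vertex k.+1) : W_vertex k.+2 :=
  match v with
  | inl true => layer_vertex ord0 true 0
  | inl false => inl false
  | inr (i, c, s) => inr (lift ord0 i, c, s)
  end.

(** Only the first and second layers matter, so the vertex [x] is split by layer: first, second or
    later. The end [u] of each move lies in the first layer, hence is not adjacent to [b] or to a
    later layer; the conjunction evaluates to false there with [k] left variable. *)
Lemma first_layer_moves_valid (k : nat) :
  subdivides_seq (xpredT, @W4' k.+2) (first_layer_moves k).
Proof.
rewrite /first_layer_moves /=.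
do 6?[split; first split] => //.
all: by case=> [[]|[[[[|[|i]] lti] []] [[|[|[|s]]] lts]]].
Qed.

Lemma first_layer_moves_vertices (k : nat) (w : W_vertex k.+2) :
  (foldl (@unsubdivide _) (xpredT, @W4' k.+2) (first_layer_moves k)).1 w =
  (w \in codom (@shift_vertex k)).
Proof.
apply/idP/codomP; last first.
  by move=> [[[]|[[[[|i] lti] []] [[|[|[|s]]] lts]]] ->].
case: w => [[]|[[[[|i] lti] c] s]] //.
- by move=> _; exists (inl false).
- case: c; case: s => [[|[|[|s]]] lts] // _; exists (inl true).
  by congr (inr (_, _, _)); exact: val_inj.
- move=> _; exists (inr (Ordinal (lti : (i < k.+1)%N), c, s)).
  by congr (inr (_, _, _)); exact: val_inj.
Qed.

(** Of the six added edges only the last two join surviving vertices: they link y^1_1 to z^2_3 and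
    z^2_1. As y^1_1 is already adjacent to every y^2_t, and to z^2_2 by the extra edge of [W4'], it
    becomes adjacent to the whole second layer, as [a] must be. *)
Lemma first_layer_moves_edges (k : nat) (u v : W_vertex k.+1) :
  u != v ->
  (foldl (@unsubdivide _) (xpredT, @W4' k.+2) (first_layer_moves k)).2
    (shift_vertex u) (shift_vertex v) = W4' u v.
Proof.
case: u => [[]|[[[[|i] lti] []] [[|[|[|s]]] lts]]] //;
case: v => [[]|[[[[|j] ltj] []] [[|[|[|t]]] ltt]]] //.
Qed.

Lemma shift_vertex_inj (k : nat) : injective (@shift_vertex k).
Proof.
move=> [[]|[[i c] s]] [[]|[[j c'] t]] //= -[] // ij -> ->.
by congr (inr (_, _, _)); exact: val_inj.
Qed.

(** * The case of one layer, and the induction *)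

(** With one layer the non-adjacent pairs of distinct vertices are [a], [b] and the three pairs y_s,
    z_s. These are the four pairs of opposite vertices of the cross-polytope; [h] sends axis 0 to
    the first pair. *)
Lemma octahedron_suspension_homeo (R : realType) :
  ambient_homeo (@realization _ R (clique_complex (@W4' 1)))
                (@unit_sphere R 3).
Proof.
apply: ambient_homeo_trans (cross_polytope_homeo R 3).
apply: ambient_homeo_sym.
pose h (p : 'I_4 * bool) : W_vertex 1 :=
  match p with
  | (@Ordinal _ 0 _, c) => inl c
  | (@Ordinal _ s.+1 lts, c) => inr (ord0, c, @Ordinal 3 s lts)
  end.
rewrite -(cliques_on_predT (@W4' 1)); apply: (@relabel_homeo R _ _ h).
- move=> [[[|s] lts] c] [[[|t] ltt] c'] //= [].
    by move=> ->; congr (_, _); exact: val_inj.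
  by move=> -> st; congr (_, _); apply: val_inj; rewrite /= st.
- move=> [c|[[[[|i] lti] c] [s lts]]]; apply/esym/codomP => //.
    by exists (ord0, c).
  exists (Ordinal (lts : (s.+1 < 4)%N), c).
  by congr (inr (_, _, _)); exact: val_inj.
- by move=> [[[|[|[|[|s]]]] lts] []] [[[|[|[|[|t]]]] ltt] []].
Qed.

Lemma W4'_homeo (R : realType) (k : nat) :
  ambient_homeo (@realization _ R (clique_complex (@W4' k.+1)))
                (@unit_sphere R 3).
Proof.
elim: k => [|k IH]; first exact: octahedron_suspension_homeo.
apply: ambient_homeo_trans IH; rewrite -(cliques_on_predT (@W4' k.+2)).
(* The moves lead to the graph on the surviving vertices, which [shift_vertex] identifies with the
   graph having one layer fewer. *)
have /ambient_homeo_trans := @subdivides_seq_homeo _ R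
  (xpredT, @W4' k.+2) _ (@W4'_sym k.+2) (first_layer_moves_valid k); apply.
apply: ambient_homeo_sym; apply: (relabel_homeo R (@shift_vertex_inj k)).
  exact: first_layer_moves_vertices.
exact: first_layer_moves_edges.
Qed.

Theorem theorem2p4 (R : realType) (k : nat) (hk : (1 <= k)%N) :
  flag_sphere R 3 (clique_complex (@W4' k)).
Proof.
split; [exact: simplicial_clique_complex|exact: flag_clique_complex|].
by case: k hk => // k _; exact/ambient_homeo_homeomorphic/W4'_homeo.
Qed.
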